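(* Let $n$ be a positive integer with $n\equiv 0\pmod 4$. If there exists a skew-symmetric conference matrix of order $n$, then there exists a $3$-$(n,4,n/4)$ design with the property that every set of $5$ vertices contains either exactly $0$ or exactly $2$ hyperedges.
   Context: A skew-symmetric conference matrix of order $n$ is an $n\times n$ matrix $S$ with zero diagonal and all off-diagonal entries in $\{-1,1\}$ such that $S^{\top}=-S$ and $SS^{\top}=(n-1)I$. A $t$-$(v,k,\lambda)$ design is a $k$-uniform hypergraph on a $v$-element vertex set such that any set of $t$ vertices is contained in exactly $\lambda$ hyperedges. *)

(* Defs.v *)
From mathcomp Require Import all_boot all_order all_algebra.

Set Implicit Arguments.
Unset Strict Implicit.
Unset Printing Implicit Defensive.

Import GRing.Theory.

Local Open Scope ring_scope.

(* Entries are taken in [int]: the definition only allows 0, 1 and -1. *)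
Definition skew_conference n (S : 'M[int]_n) : Prop :=
  [/\ forall i, S i i = 0,
      forall i j, i != j -> S i j = -1 \/ S i j = 1,
      S^T = - S
    & S *m S^T = ((n%:R - 1)%:M : 'M[int]_n)].

Local Open Scope nat_scope.

(* A hypergraph on the finite vertex set [V] is its set of hyperedges. *)
Definition uniform_hypergraph (k : nat) (V : finType) (E : {set {set V}}) :
    Prop :=
  forall e : {set V}, e \in E -> #|e| = k.

Definition is_design (t v k lambda : nat) (V : finType) (E : {set {set V}}) :
    Prop :=
  [/\ #|V| = v,
      uniform_hypergraph k E
    & forall T : {set V}, #|T| = t -> #|[set e in E | T \subset e]| = lambda].

(* Main.v *)
Require Import Defs.
From mathcomp Require Import all_boot all_order all_algebra.
From mathcomp Require Import zify ring.

(** For a skew-symmetric [S] with off-diagonal entries [1] and [-1], the Pfaffian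
    [S a b * S c d - S a c * S b d + S a d * S b c] of a 4-subset is, up to sign,
    [1] or [3]; the hyperedges are the 4-subsets for which it is [3] or [-3].
    Summing the squared Pfaffian over [d], with [a], [b], [c] fixed, the cross
    terms vanish by orthogonality of the rows, and so do the terms with [d] in
    [{a, b, c}]. If [x] of the remaining [n - 3] squares are equal to [9], then
    [9 x + (n - 3 - x) = 3 (n - 1)], that is [x = n / 4]. That a 5-set contains
    0 or 2 hyperedges holds for every tournament, by a finite check. *)

Set Implicit Arguments.
Unset Strict Implicit.
Unset Printing Implicit Defensive.

Import GRing.Theory.

(* With [T x y] meaning [S x y = 1], the three equalities are the signs of the
   three terms of the Pfaffian. *)
Definition pf3 (V : finType) (T : rel V) (a b c d : V) : bool :=
  let q := T a c == T b d in
  ((T a b == T c d) != q) && ((T a d == T b c) != q).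

Definition pf3_hypergraph (V : finType) (T : rel V) : {set {set V}} :=
  [set e : {set V} | [exists a, exists b, exists c, exists d,
     [&& uniq [:: a; b; c; d], e == [set a; b; c; d] & pf3 T a b c d]]].

Section Tournament.

Variables (V : finType) (T : rel V).
Hypothesis T_tournament : forall x y, x != y -> T y x = ~~ T x y.

(** Permuting the four indices of a Pfaffian changes at most its sign, so whether its absolute value
    is 3 depends only on the underlying set. Hence membership in the hypergraph can be tested in any
    ordering. *)
Lemma pf3_perm a b c d a' b' c' d' :
  uniq [:: a; b; c; d] -> uniq [:: a'; b'; c'; d'] ->
  [set a; b; c; d] = [set a'; b'; c'; d'] ->
  pf3 T a b c d = pf3 T a' b' c' d'.
Proof.
move=> u u' eqs.
have inl x : x \in [:: a'; b'; c'; d'] -> x \in [:: a; b; c; d].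
  have : (x \in [set a; b; c; d]) = (x \in [set a'; b'; c'; d']) by rewrite eqs.
  by rewrite !inE -!orbA => ->.
have Ha : a' \in [:: a; b; c; d] by rewrite inl // !inE eqxx ?orbT.
have Hb : b' \in [:: a; b; c; d] by rewrite inl // !inE eqxx ?orbT.
have Hc : c' \in [:: a; b; c; d] by rewrite inl // !inE eqxx ?orbT.
have Hd : d' \in [:: a; b; c; d] by rewrite inl // !inE eqxx ?orbT.
move: u; rewrite /= !inE !negb_or !andbT => /and3P[/and3P[ab ac ad] /andP[bc bd] cd].
move: u'; rewrite /= !inE !negb_or !andbT => /and3P[/and3P[ab' ac' ad'] /andP[bc' bd'] cd'].
rewrite !inE {eqs inl} in Ha Hb Hc Hd; rewrite /pf3.
(* These equations reduce every arc to one of the six values of [T] on pairs taken in the order [a],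
   [b], [c], [d]; each of the 24 orderings is then a truth table. *)
have := (T_tournament ab, T_tournament ac, T_tournament ad,
         T_tournament bc, T_tournament bd, T_tournament cd).
case/or4P: Ha => /eqP ?; subst a'; case/or4P: Hb => /eqP ?; subst b';
  rewrite ?eqxx // in ab';
  case/or4P: Hc => /eqP ?; subst c'; rewrite ?eqxx // in ac' bc';
  case/or4P: Hd => /eqP ?; subst d'; rewrite ?eqxx // in ad' bd' cd';
  move=> tr; rewrite ?tr;
  by case: (T a b) (T a c) (T a d) (T b c) (T b d) (T c d) => [] [] [] [] [] [].
Qed.

Lemma mem_pf3_hypergraph a b c d :
  uniq [:: a; b; c; d] ->
  ([set a; b; c; d] \in pf3_hypergraph T) = pf3 T a b c d.
Proof.
move=> u; rewrite inE; apply/idP/idP => [|h].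
  case/existsP=> a' /existsP[b' /existsP[c' /existsP[d' /and3P[u' /eqP e h]]]].
  by rewrite (pf3_perm u u' e).
apply/existsP; exists a; apply/existsP; exists b; apply/existsP; exists c.
by apply/existsP; exists d; rewrite u eqxx h.
Qed.

Lemma pf3_hypergraph_uniform : uniform_hypergraph 4 (pf3_hypergraph T).
Proof.
move=> e; rewrite inE.
case/existsP=> a /existsP[b /existsP[c /existsP[d /and3P[u /eqP-> _]]]].
have -> : [set a; b; c; d] = [set x in [:: a; b; c; d]].
  by apply/setP=> x; rewrite !inE -!orbA.
by rewrite cardsE (card_uniqP u).
Qed.

(** A hyperedge containing the triple is determined by its fourth vertex, so the degree of the
    triple becomes a count over [d], the index summed over in the Pfaffian identity. *)
Lemma card_pf3_hypergraph_sup a b c :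
  uniq [:: a; b; c] ->
  #|[set e in pf3_hypergraph T | [set a; b; c] \subset e]| =
  #|[set d | (d \notin [set a; b; c]) && pf3 T a b c d]|.
Proof.
move=> u.
have uniq4 d : d \notin [set a; b; c] -> uniq [:: a; b; c; d].
  move=> dN; rewrite -[[:: a; b; c; d]]/(rcons [:: a; b; c] d) rcons_uniq u.
  by move: dN; rewrite !inE -!orbA => ->.
have addE d : [set a; b; c; d] = d |: [set a; b; c].
  by rewrite setUC.
rewrite -(@card_in_imset _ _ (fun d => d |: [set a; b; c])); last first.
  move=> d d'; rewrite [d \in _]in_set [d' \in _]in_set => /andP[dN _] /andP[dN' _].
  move=> e; have := setU11 d [set a; b; c].
  by rewrite e in_setU1 (negPf dN) orbF => /eqP.
apply: eq_card => e; rewrite [e \in _]in_set.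
apply/andP/imsetP => [[eE sub]|[d]].
  have c4 := pf3_hypergraph_uniform eE.
  have c3 : #|[set a; b; c]| = 3.
    have -> : [set a; b; c] = [set x in [:: a; b; c]].
      by apply/setP=> x; rewrite !inE -!orbA.
    by rewrite cardsE (card_uniqP u).
  have /cards1P[d dE] : #|e :\: [set a; b; c]| == 1.
    by rewrite cardsD (setIidPr sub) c4 c3.
  have eU : e = d |: [set a; b; c].
    by rewrite -dE setUC -{1}(setID e [set a; b; c]) (setIidPr sub).
  have dN : d \notin [set a; b; c].
    by have := set11 d; rewrite -dE in_setD => /andP[].
  exists d => //; rewrite in_set dN -mem_pf3_hypergraph ?uniq4 //.
  by rewrite addE -eU.
rewrite in_set => /andP[dN h] ->; split; last exact: subsetUr.
by move: h; rewrite -mem_pf3_hypergraph ?uniq4 // addE.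
Qed.

(** A hyperedge inside a 5-set misses exactly one of its points, and that point determines it. *)
Lemma card_pf3_hypergraph_sub (A : {set V}) :
  #|A| = 5 ->
  #|[set e in pf3_hypergraph T | e \subset A]| =
  \sum_(x in A) (A :\ x \in pf3_hypergraph T).
Proof.
move=> A5.
rewrite -big_mkcondr /= sum1_card -cardsE.
rewrite -(@card_in_imset _ _ (fun x => A :\ x)); last first.
  move=> x y; rewrite [x \in _]in_set [y \in _]in_set => /andP[xA _] /andP[yA _].
  by move/setP/(_ x); rewrite !inE eqxx xA andbT; case: eqP.
apply: eq_card => e; rewrite in_set.
apply/andP/imsetP => [[eE sub]|[x]].
  have /cards1P[x xE] : #|A :\: e| == 1.
    by rewrite cardsD (setIidPr sub) A5 (pf3_hypergraph_uniform eE).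
  have eD : e = A :\ x by rewrite -xE setDDr setDv set0U (setIidPr sub).
  exists x => //; rewrite in_set unfold_in -eD eE andbT.
  by have := set11 x; rewrite -xE in_setD => /andP[].
by rewrite in_set => /andP[_ ?] ->; split=> //; apply: subD1set.
Qed.

Lemma pf3_hypergraph_5set (A : {set V}) :
  #|A| = 5 ->
  let m := #|[set e in pf3_hypergraph T | e \subset A]| in m = 0 \/ m = 2.
Proof.
move=> A5 /=; rewrite card_pf3_hypergraph_sub //.
have := enum_uniq A; have := cardE A; rewrite A5.
case eA: (enum A) => [|a [|b [|c [|d [|e [|? ?]]]]]] // _ u.
have AE x : (x \in A) = (x \in [:: a; b; c; d; e]) by rewrite -eA mem_enum.
have DE x p q r s : perm_eq [:: a; b; c; d; e] [:: x; p; q; r; s] ->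
    (A :\ x \in pf3_hypergraph T) = pf3 T p q r s.
  move=> eqp; have := u; rewrite (perm_uniq eqp) cons_uniq => /andP[xN uN].
  suff -> : A :\ x = [set p; q; r; s] by rewrite mem_pf3_hypergraph.
  apply/setP=> y; rewrite in_setD1 AE (perm_mem eqp).
  rewrite !inE in xN; rewrite !inE -!orbA.
  by case: (altP (y =P x)) => //= ->; rewrite (negPf xN).
rewrite -big_enum /= eA !big_cons big_nil.
(* The four remaining vertices keep the order of the enumeration, so only the ten values of [T] on
   increasing pairs occur, and 1024 cases settle the claim. *)
rewrite (DE a b c d e) // (DE b a c d e) ?(DE c a b d e) ?(DE d a b c e) ?(DE e a b c d);
  try by apply/seq.permP=> f /=; lia.
rewrite /pf3.
case: (T a b) (T a c) (T a d) (T a e) (T b c) => [] [] [] [] [];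
case: (T b d) (T b e) (T c d) (T c e) (T d e) => [] [] [] [] [];
by [left | right].
Qed.

End Tournament.

Section ConferenceMatrix.

Local Open Scope ring_scope.

Variables (n : nat) (S : 'M[int]_n).
Hypothesis S_conf : skew_conference S.

Definition pos_rel : rel 'I_n := fun i j => S i j == 1.

Definition pfaffian4 (a b c d : 'I_n) : int :=
  S a b * S c d - S a c * S b d + S a d * S b c.

Lemma conf_skew i j : S j i = - S i j.
Proof. by case: S_conf => _ _ /matrixP/(_ i j) + _; rewrite !mxE. Qed.

Lemma conf_row_dot i j : \sum_k S i k * S j k = (n%:R - 1) *+ (i == j).
Proof.
case: S_conf => _ _ _ /matrixP/(_ i j); rewrite !mxE => <-.
by apply: eq_bigr => k _; rewrite mxE.
Qed.

Lemma conf_entry i j : i != j -> S i j = if pos_rel i j then 1 else -1.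
Proof. by case: S_conf => _ + _ _ => /[apply]; rewrite /pos_rel => -[] ->. Qed.

Lemma pos_rel_tournament i j : i != j -> pos_rel j i = ~~ pos_rel i j.
Proof.
move=> ij; rewrite /pos_rel (conf_skew i j) (conf_entry ij).
by case: ifP.
Qed.

Lemma pfaffian4_sqr a b c d : uniq [:: a; b; c; d] ->
  pfaffian4 a b c d ^+ 2 = 1 + 8 * (pf3 pos_rel a b c d)%:R.
Proof.
rewrite /= !inE !negb_or !andbT => /and3P[/and3P[ab ac ad] /andP[bc bd] cd].
rewrite /pfaffian4 !conf_entry // /pf3.
by case: (pos_rel a b) (pos_rel a c) (pos_rel a d) (pos_rel b c) (pos_rel b d)
  (pos_rel c d) => [] [] [] [] [] [].
Qed.

(** As a function of [d], the Pfaffian is a combination of rows [a], [b], [c] of [S] with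
    coefficients 1 or -1. These rows are orthogonal of squared norm [n - 1], so Pythagoras gives the
    sum. *)
Lemma pfaffian4_sqr_sum a b c : uniq [:: a; b; c] ->
  \sum_d pfaffian4 a b c d ^+ 2 = 3 * (n%:R - 1).
Proof.
rewrite /= !inE !negb_or !andbT => /andP[/andP[ab ac] bc].
have sq i j : i != j -> S i j ^+ 2 = 1.
  by move=> /conf_entry->; case: ifP.
transitivity (S a b ^+ 2 * (\sum_d S c d * S c d)
  + S a c ^+ 2 * (\sum_d S b d * S b d) + S b c ^+ 2 * (\sum_d S a d * S a d)
  + (- 2 * S a b * S a c) * (\sum_d S c d * S b d)
  + (2 * S a b * S b c) * (\sum_d S c d * S a d)
  + (- 2 * S a c * S b c) * (\sum_d S b d * S a d)).
  rewrite !big_distrr -!big_split /=.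
  by apply: eq_bigr => d _; rewrite /pfaffian4; ring.
rewrite !conf_row_dot !eqxx !sq // ![_ == a]eq_sym [c == b]eq_sym.
by rewrite (negPf ab) (negPf ac) (negPf bc) /=; ring.
Qed.

Lemma card_pf3_pos_rel a b c : uniq [:: a; b; c] -> n = 0 %[mod 4] ->
  #|[set d | (d \notin [set a; b; c]) && pf3 pos_rel a b c d]| = (n %/ 4)%N.
Proof.
move=> u n4; set X := [set d | _].
have tE : [set a; b; c] = [set x in [:: a; b; c]].
  by apply/setP=> x; rewrite !inE -!orbA.
have t3 : #|[set a; b; c]| = 3%N by rewrite tE cardsE (card_uniqP u).
have S0 i : S i i = 0 by case: S_conf.
have split_sum : \sum_d pfaffian4 a b c d ^+ 2 =
    \sum_(d in ~: [set a; b; c]) (1 + 8 * (d \in X)%:R).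
  rewrite (bigID (mem [set a; b; c])) /= big1 ?add0r => [|d].
    apply: eq_big => [d|d dN]; first by rewrite in_setC.
    have uN : uniq [:: a; b; c; d].
      rewrite -[[:: a; b; c; d]]/(rcons [:: a; b; c] d) rcons_uniq u.
      by move: dN; rewrite tE in_set => ->.
    by rewrite pfaffian4_sqr // in_set dN.
  (* With [d] equal to [a], [b] or [c], one term contains a diagonal entry and the other two cancel
     by skew-symmetry. *)
  rewrite /pfaffian4 !inE -orbA => /or3P[] /eqP->;
    rewrite S0 ?(conf_skew a b) ?(conf_skew a c) ?(conf_skew b c); ring.
have := pfaffian4_sqr_sum u; rewrite split_sum big_split /= -big_distrr /=.
rewrite sumr_const cardsCs setCK t3 card_ord -natr_sum -big_mkcondr /= sum1_card.
have -> : #|[pred d | (d \in ~: [set a; b; c]) && (d \in X)]| = #|X|.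
  by apply: eq_card => d; rewrite !inE andbA andbb.
(* The complement of the triple has [n - 3] elements in truncated subtraction; this bound lets it be
   cast to [int]. The equation is then [(n - 3) + 8 x = 3 (n - 1)], that is [4 x = n]. *)
have le3n : (3 <= n)%N by rewrite -t3 -[leqRHS]card_ord max_card.
rewrite natrB //; move: #|X| => x; lia.
Qed.

End ConferenceMatrix.

Theorem mainTheorem2 (n : nat) (n_gt0 : 0 < n) (n_mod4 : n = 0 %[mod 4]) :
  (exists S : 'M[int]_n, skew_conference S) ->
  exists (V : finType) (E : {set {set V}}),
    is_design 3 n 4 (n %/ 4) E /\
    (forall A : {set V}, #|A| = 5 ->
       #|[set e in E | e \subset A]| = 0 \/ #|[set e in E | e \subset A]| = 2).
Proof.
case=> S S_conf; have trn := pos_rel_tournament S_conf.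
exists 'I_n, (pf3_hypergraph (pos_rel S)).
split; last exact: pf3_hypergraph_5set.
split; [exact: card_ord | exact: pf3_hypergraph_uniform |].
move=> A A3; have := enum_uniq A; have := cardE A; rewrite A3.
case eA: (enum A) => [|a [|b [|c [|? ?]]]] // _ u.
have -> : A = [set a; b; c].
  by apply/setP=> x; rewrite -mem_enum eA !inE -!orbA.
by rewrite card_pf3_hypergraph_sup // card_pf3_pos_rel.
Qed.
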